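(* Let $n=1$, and let $H(y,p)=-V(y)+\frac12 p^2$ for $(y,p)\in\mathbb{T}\times\mathbb{R}$, where $V\in C(\mathbb{T})$ is a given continuous function with $\min_{\mathbb{T}}V=0$ and $V\ge 1$ on $\left[-\frac13,\frac13\right]$. For $\epsilon>0$, let $u^\epsilon$ be the viscosity solution to $$u^\epsilon_t+H\left(\frac{x}{\epsilon},Du^\epsilon\right)=0\ \text{ in }\mathbb{R}\times(0,\infty),\qquad u^\epsilon(x,0)=0\ \text{ on }\mathbb{R},$$ and let $u$ be the viscosity solution to $$u_t+\overline{H}(Du)=0\ \text{ in }\mathbb{R}\times(0,\infty),\qquad u(x,0)=0\ \text{ on }\mathbb{R},$$ where $\overline{H}$ is the effective Hamiltonian of $H$. Then, for all $\epsilon\in(0,1)$ and $t>0$, $$u^\epsilon(0,t)-u(0,t)\ge\frac{\sqrt2}{3}\min\{t,\epsilon\}.$$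
   Context: $\mathbb{T}=\mathbb{R}/\mathbb{Z}$; functions on $\mathbb{T}$ are identified with $1$-periodic functions on $\mathbb{R}$, so $V\ge1$ on $[-\frac13,\frac13]$ refers to the $1$-periodic function on $\mathbb{R}$. Effective Hamiltonian: for each $p\in\mathbb{R}$, $\overline{H}(p)$ is the unique real constant for which the cell problem $H(y,p+Dv(y))=\overline{H}(p)$ for $y\in\mathbb{T}$ has a continuous (periodic) viscosity solution $v:\mathbb{T}\to\mathbb{R}$. Solutions of the Cauchy problems are viscosity solutions, unique in the class of functions that are bounded and uniformly continuous on $\mathbb{R}\times[0,T]$ for every $T>0$. *)

(* Defs.v *)
From HB Require Import structures.
From mathcomp Require Import all_boot all_order all_algebra.
From mathcomp Require Import all_classical all_reals all_analysis.
Set Implicit Arguments.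
Unset Strict Implicit.
Unset Printing Implicit Defensive.
Import Order.TTheory GRing.Theory Num.Theory.
Import numFieldNormedType.Exports.
Local Open Scope classical_set_scope.
Local Open Scope ring_scope.

Section Viscosity.
Variable R : realType.

(* Functions on the torus are 1-periodic functions on R.  Testing with
   non-periodic C^1 functions is harmless, since touching is local. *)
Definition C1_line (phi : R -> R) : Prop :=
  (forall y, derivable phi y 1) /\ continuous (derive1 phi).

(* A point z : R * R is a pair (x, t) = (space, time). *)
Definition spacetime : set (R * R) := [set z | 0 < z.2].

Definition Dx (phi : R * R -> R) (z : R * R) : R := 'D_((1, 0) : R * R) phi z.
Definition Dt (phi : R * R -> R) (z : R * R) : R := 'D_((0, 1) : R * R) phi z.

Definition C1_spacetime (phi : R * R -> R) : Prop :=
  forall z, spacetime z ->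
    [/\ derivable phi z (1, 0), derivable phi z (0, 1),
        {for z, continuous (Dx phi)} & {for z, continuous (Dt phi)}].

(* [u - phi] has a local maximum (resp. minimum) at [z]. *)
Definition touches_above (T : topologicalType) (u phi : T -> R) (z : T) : Prop :=
  \forall w \near z, u w - phi w <= u z - phi z.

Definition touches_below (T : topologicalType) (u phi : T -> R) (z : T) : Prop :=
  \forall w \near z, u z - phi z <= u w - phi w.

(* Stationary equation F(y, Dv) = 0 on the torus. *)
Definition stationary_subsolution (F : R -> R -> R) (v : R -> R) : Prop :=
  forall phi y, C1_line phi -> touches_above v phi y -> F y (derive1 phi y) <= 0.

Definition stationary_supersolution (F : R -> R -> R) (v : R -> R) : Prop :=
  forall phi y, C1_line phi -> touches_below v phi y -> 0 <= F y (derive1 phi y).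

Definition torus_viscosity_solution (F : R -> R -> R) (v : R -> R) : Prop :=
  [/\ continuous v, periodic v 1,
      stationary_subsolution F v & stationary_supersolution F v].

(* [Hbar p] is the unique constant c for which the cell problem
   H(y, p + Dv) = c has a continuous periodic viscosity solution. *)
Definition cell_solvable (H : R -> R -> R) (p c : R) : Prop :=
  exists v, torus_viscosity_solution (fun y q => H y (p + q) - c) v.

Definition effective_hamiltonian (H : R -> R -> R) (Hbar : R -> R) : Prop :=
  forall p, unique (cell_solvable H p) (Hbar p).

(* Evolution equation u_t + G(x, Du) = 0 in R x (0, oo). *)
Definition evolution_subsolution (G : R -> R -> R) (u : R * R -> R) : Prop :=
  forall phi z, spacetime z -> C1_spacetime phi -> touches_above u phi z ->
    Dt phi z + G z.1 (Dx phi z) <= 0.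

Definition evolution_supersolution (G : R -> R -> R) (u : R * R -> R) : Prop :=
  forall phi z, spacetime z -> C1_spacetime phi -> touches_below u phi z ->
    0 <= Dt phi z + G z.1 (Dx phi z).

Definition strip (T : R) : set (R * R) := [set z | 0 <= z.2 <= T].

(* Bounded and uniformly continuous on R x [0, T] for every T > 0; the values
   of [u] at negative times play no role. *)
Definition BUC_finite_time (u : R * R -> R) : Prop :=
  forall T : R, 0 < T ->
    [bounded u z | z in strip T] /\ unif_continuous (u : subspace (strip T) -> R).

Definition cauchy_solution (G : R -> R -> R) (g : R -> R) (u : R * R -> R)
    : Prop :=
  [/\ BUC_finite_time u, evolution_subsolution G u, evolution_supersolution G u
    & forall x, u (x, 0) = g x].

Definition mechanical (V : R -> R) (y p : R) : R := - V y + 2^-1 * p ^+ 2.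

End Viscosity.

(* Main.v *)
(* Touching a corrector from above near a zero of V shows Hbar >= 0, so constants
   are supersolutions of the effective equation and u <= 0; hence it suffices to
   bound u^eps(0, t) from below.  Since V >= 0, also u^eps >= 0.  With
   l = min(t, eps) / 3, one has V(x / eps) >= 1 for |x| <= l, where
   min(s - s^2 / (2 t), sqrt 2 (l - |x|)) is an almost everywhere subsolution in
   (x, s), nonpositive on the boundary of [-l, l] x [0, 2 t], with value sqrt 2 l
   at (0, t).  Being a minimum of three C^1 functions a_i, it is approximated by
   the C^1 strict subsolutions - kap ln (sum_i exp (- a_i / kap)), which can be
   used directly as test functions for u^eps, without a comparison principle. *)
Require Import Defs.
From HB Require Import structures.
From mathcomp Require Import all_boot all_order all_algebra.
From mathcomp Require Import all_classical all_reals all_analysis.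
From mathcomp Require Import ring lra.
Set Implicit Arguments.
Unset Strict Implicit.
Unset Printing Implicit Defensive.
Import Order.TTheory GRing.Theory Num.Theory.
Import numFieldNormedType.Exports.
Local Open Scope classical_set_scope.
Local Open Scope ring_scope.

(** * Test functions in space-time and interior maxima on rectangles *)

Section TestFunctions.
Variable R : realType.
Implicit Types (phi px pt : R -> R -> R) (z : R * R).

Lemma is_derive_space (f : R * R -> R) z d :
  is_derive z.1 1 (fun x => f (x, z.2)) d -> is_derive z (1, 0) f d.
Proof.
move=> [df <-]; rewrite /derivable /derive in df *.
have E : (fun h : R => h^-1 *: ((f \o shift z) (h *: (1, 0)) - f z)) =
  (fun h => h^-1 *: (((fun x => f (x, z.2)) \o shift z.1) (h *: 1) - f (z.1, z.2))).
  apply/funext => h /=; case: z df => a b df.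
  have -> : h *: (1, 0) + (a, b) = (h *: (1 : R^o) + a, h *: (0 : R^o) + b) :> R * R by [].
  by rewrite scaler0 add0r.
by split; rewrite /derivable /derive E.
Qed.

Lemma is_derive_time (f : R * R -> R) z d :
  is_derive z.2 1 (fun t => f (z.1, t)) d -> is_derive z (0, 1) f d.
Proof.
move=> [df <-]; rewrite /derivable /derive in df *.
have E : (fun h : R => h^-1 *: ((f \o shift z) (h *: (0, 1)) - f z)) =
  (fun h => h^-1 *: (((fun t => f (z.1, t)) \o shift z.2) (h *: 1) - f (z.1, z.2))).
  apply/funext => h /=; case: z df => a b df.
  have -> : h *: (0, 1) + (a, b) = (h *: (0 : R^o) + a, h *: (1 : R^o) + b) :> R * R by [].
  by rewrite scaler0 add0r.
by split; rewrite /derivable /derive E.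
Qed.

Lemma test_functionP phi px pt :
    (forall x t, is_derive x (1 : R) (phi^~ t) (px x t)) ->
    (forall x t, is_derive t (1 : R) (phi x) (pt x t)) ->
    continuous (fun z => px z.1 z.2) -> continuous (fun z => pt z.1 z.2) ->
  let f z := phi z.1 z.2 in
  [/\ C1_spacetime f, Dx f = fun z => px z.1 z.2 & Dt f = fun z => pt z.1 z.2].
Proof.
move=> dx dt cx ct f.
have fx z : is_derive z (1, 0) f (px z.1 z.2) by apply: is_derive_space; exact: dx.
have ft z : is_derive z (0, 1) f (pt z.1 z.2) by apply: is_derive_time; exact: dt.
have Ex : Dx f = fun z => px z.1 z.2.
  by apply/funext => z; rewrite /Dx derive_val.
have Et : Dt f = fun z => pt z.1 z.2.
  by apply/funext => z; rewrite /Dt derive_val.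
by split=> // z _; rewrite Ex Et; split; [exact: ex_derive|exact: ex_derive|exact: cx|exact: ct].
Qed.

Lemma unif_continuous_continuous (U W : uniformType) (f : U -> W) :
  unif_continuous f -> continuous f.
Proof.
move=> uf x; apply/cvg_entourageP => E entE.
have := uf _ entE; rewrite /nbhs/= => entU.
by apply: filterS (nbhs_entourage x entU) => y; rewrite /xsection/= inE.
Qed.

Definition rectangle (a b c d : R) : set (R * R) := `[a, b] `*` `[c, d].

Lemma compact_rectangle a b c d : compact (rectangle a b c d).
Proof. by apply: compact_setX; exact: segment_compact. Qed.

(** The maximum over the compact rectangle exceeds [m], which bounds [f] on all four sides, so it is
    attained in the interior. This yields the points at which viscosity inequalities are tested. *)
Lemma interior_local_max (f : R * R -> R) a b c d (z0 : R * R) (m : R) :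
    {within rectangle a b c d, continuous f} ->
    rectangle a b c d z0 -> m < f z0 ->
    (forall x t, a <= x <= b -> c <= t <= d ->
       [\/ x = a, x = b, t = c | t = d] -> f (x, t) <= m) ->
  exists z, [/\ a < z.1 < b, c < z.2 < d, f z0 <= f z &
                \forall w \near z, f w <= f z].
Proof.
move=> cf z0K mf bd.
have [|z zK zmax] := compact_EVT_max _ (@compact_rectangle a b c d) cf.
  by exists z0.
have fz : f z0 <= f z by apply: zmax; rewrite inE.
case: z zK fz zmax => x t; rewrite inE => -[/= xab tcd] fz zmax.
rewrite !in_itv/= in xab tcd.
have nb : ~ [\/ x = a, x = b, t = c | t = d].
  by move=> /(bd _ _ xab tcd); apply/negP; rewrite -ltNge (lt_le_trans mf).
have xab' : a < x < b.
  by rewrite !lt_neqAle; case/andP: xab => -> ->; rewrite !andbT; apply/andP; split;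
    apply/eqP => e; apply: nb; [apply: Or41|apply: Or42].
have tcd' : c < t < d.
  by rewrite !lt_neqAle; case/andP: tcd => -> ->; rewrite !andbT; apply/andP; split;
    apply/eqP => e; apply: nb; [apply: Or43|apply: Or44].
exists (x, t); split => //.
exists (`]a, b[%classic, `]c, d[%classic); first by split; apply: near_in_itvoo; rewrite in_itv.
move=> [y s] /= [yab scd]; apply: zmax; rewrite inE; split => /=; exact: subset_itv_oo_cc.
Qed.
End TestFunctions.

(** * Nonnegativity of the effective Hamiltonian *)

Section CellProblem.
Variable R : realType.

Lemma is_derive_quadratic (K c x : R) :
  is_derive x (1 : R) (fun y => K * (y - c) ^+ 2) (2 * K * (x - c)).
Proof.
have -> : (fun y => K * (y - c) ^+ 2) = K \*: ((id - cst c) ^+ 2).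
  by apply/funext => y; rewrite /= !fctE.
by apply: is_derive_eq; rewrite /= subr0 /GRing.scale/= !fctE; ring.
Qed.

(** A steep parabola centred at [y0] touches the corrector from above at some [y] so close to [y0]
    that [V y < e]. The kinetic term being nonnegative, the subsolution inequality gives
    [c >= - V y > - e]. *)
Lemma cell_solvable_ge0 (V : R -> R) (y0 p c : R) :
  continuous V -> V y0 = 0 -> cell_solvable (mechanical V) p c -> 0 <= c.
Proof.
move=> cV V0 [v [cv _ subv _]]; apply/ler_addgt0Pr => e e0.
have /cvgrPdist_lt /(_ e e0) /nbhs_ballP[r /= r0 rV] := cV y0.
pose d := r / 2; have d0 : 0 < d by rewrite divr_gt0.
(* At both endpoints [y0 - d] and [y0 + d] the parabola exceeds the increment of [v] from [y0] by at
   least 1, so [v - phi] has its maximum strictly inside. *)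
pose K := (`|v (y0 - d) - v y0| + `|v (y0 + d) - v y0| + 1) / d ^+ 2.
pose phi y := K * (y - y0) ^+ 2.
have Kd : K * d ^+ 2 = `|v (y0 - d) - v y0| + `|v (y0 + d) - v y0| + 1.
  by rewrite mulfVK // expf_neq0 // gt_eqF.
have dphi y : is_derive y (1 : R) phi (2 * K * (y - y0)).
  exact: is_derive_quadratic.
have Ephi : derive1 phi = fun y => 2 * K * (y - y0).
  by apply/funext => y; rewrite derive1E derive_val.
have C1 : C1_line phi.
  split=> [y|]; first exact: ex_derive.
  rewrite Ephi => y; apply: cvgM; first exact: cvg_cst.
  by apply: cvgB; [exact: cvg_id|exact: cvg_cst].
have cphi : continuous phi.
  by move=> y; apply/differentiable_continuous/derivable1_diffP; case: C1.
have [|||y yI ymax] := @compact_EVT_max _ R (fun y => v y - phi y) `[y0 - d, y0 + d].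
- by exists y0; rewrite /= in_itv/=; lra.
- exact: segment_compact.
- by apply: continuous_subspaceT => y; apply: cvgB; [exact: cv|exact: cphi].
have phi0 : phi y0 = 0 by rewrite /phi subrr expr0n mulr0.
have y0max : v y0 <= v y - phi y.
  have := ymax y0; rewrite phi0 subr0; apply.
  by rewrite inE /= in_itv/=; lra.
have ne1 : y != y0 - d.
  apply/eqP => ye; move: y0max.
  rewrite /phi ye (_ : y0 - d - y0 = - d); last by ring.
  rewrite sqrrN Kd; have := ler_norm (v (y0 - d) - v y0).
  have := normr_ge0 (v (y0 + d) - v y0); lra.
have ne2 : y != y0 + d.
  apply/eqP => ye; move: y0max.
  rewrite /phi ye (_ : y0 + d - y0 = d); last by ring.
  rewrite Kd; have := ler_norm (v (y0 + d) - v y0).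
  have := normr_ge0 (v (y0 - d) - v y0); lra.
have yoo : y \in `]y0 - d, y0 + d[.
  move: yI; rewrite inE /= !in_itv/= => /andP[h1 h2].
  by rewrite !lt_neqAle eq_sym ne1 ne2 h1.
have touch : touches_above v phi y.
  apply: filterS (near_in_itvoo yoo) => w wI; apply: ymax.
  by rewrite inE; exact: subset_itv_oo_cc.
have := subv _ _ C1 touch; rewrite /mechanical.
have : `|V y0 - V y| < e.
  apply: rV; rewrite /ball/= ltr_norml.
  by move: yoo; rewrite in_itv/= /d; lra.
rewrite V0 sub0r normrN => /(le_lt_trans (ler_norm _)).
have := sqr_ge0 (p + derive1 phi y); lra.
Qed.
End CellProblem.

(** * Signs of the solutions of the two Cauchy problems *)

Section Signs.
Variable R : realType.
Implicit Types (u w : R * R -> R) (G : R -> R -> R).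

(** For positive parameters, the parabola confines maxima on the unbounded line and the exponential
    supplies a strictly positive time derivative. The negated barrier serves for touching from
    below. *)
Definition barrier (K A k x0 t0 x t : R) : R :=
  K * (x - x0) ^+ 2 + A * expR (k * (t - t0)).

Lemma is_derive_expR_affine (k c t : R) :
  is_derive t (1 : R) (fun s => expR (k * (s - c))) (k * expR (k * (t - c))).
Proof.
have d : is_derive t (1 : R) (k \*: (id - cst c)) k.
  by apply: is_derive_eq; rewrite subr0 /GRing.scale/= mulr1.
rewrite mulrC.
exact: (@is_derive1_comp _ expR (k \*: (id - cst c)) t _ _ (is_derive_expR _) d).
Qed.

Lemma barrier_test K A k x0 t0 : let f := fun z => barrier K A k x0 t0 z.1 z.2 in
  [/\ C1_spacetime f, Dx f = fun z => 2 * K * (z.1 - x0)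
    & Dt f = fun z => A * (k * expR (k * (z.2 - t0)))].
Proof.
apply: test_functionP (fun x _ => 2 * K * (x - x0))
  (fun _ t => A * (k * expR (k * (t - t0)))) _ _ _ _ => [x t|x t|z|z] /=.
- rewrite -[X in is_derive _ _ _ X]addr0.
  exact: is_deriveD (is_derive_quadratic _ _ _) (is_derive_cst _ _ _).
- rewrite -[X in is_derive _ _ _ X]add0r.
  exact: is_deriveD (is_derive_cst _ _ _) (is_deriveZ _ (is_derive_expR_affine _ _ _)).
- by apply: cvgM; [exact: cvg_cst|apply: cvgB; [exact: cvg_fst|exact: cvg_cst]].
- apply: cvgM; first exact: cvg_cst.
  apply: cvgM; first exact: cvg_cst.
  apply: (@continuous_comp _ _ _ (fun z => k * (z.2 - t0)) expR); last exact: continuous_expR.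
  by apply: cvgM; [exact: cvg_cst|apply: cvgB; [exact: cvg_snd|exact: cvg_cst]].
Qed.

Lemma continuous_barrier K A k x0 t0 :
  continuous (fun z : R * R => barrier K A k x0 t0 z.1 z.2).
Proof.
move=> z; apply: cvgD.
  apply: cvgM; first exact: cvg_cst.
  by apply: cvgM; apply: cvgB; [exact: cvg_fst|exact: cvg_cst|exact: cvg_fst|exact: cvg_cst].
apply: cvgM; first exact: cvg_cst.
apply: (@continuous_comp _ _ _ (fun z => k * (z.2 - t0)) expR); last exact: continuous_expR.
by apply: cvgM; [exact: cvg_cst|apply: cvgB; [exact: cvg_snd|exact: cvg_cst]].
Qed.

(* The exponential keeps the maximum away from the final time [t0 + 1], at which
   a viscosity solution cannot be tested. *)
Lemma barrier_max w (B a x0 t0 : R) :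
    0 < t0 -> 0 < a -> {within strip (t0 + 1), continuous w} ->
    (forall z, strip (t0 + 1) z -> w z <= B) -> (forall x, w (x, 0) <= 0) ->
    a < w (x0, t0) ->
  exists2 k, 0 < k & forall d, 0 < d -> exists z,
    [/\ spacetime z, d * (z.1 - x0) ^+ 2 <= B &
        touches_above w (fun z => barrier d a k x0 t0 z.1 z.2) z].
Proof.
move=> t00 a0 cw wB w0 aw.
have B0 : 0 < B.
  by rewrite (lt_trans a0)// (lt_le_trans aw)// wB// /strip/= ltW//= lerDl.
(* Since [expR k >= 1 + k], this rate makes the exponential term at least [B] at time [t0 + 1]. It
   is fixed before [d], which may therefore be chosen in terms of [k]. *)
exists (B / a) => [|d d0]; first exact: divr_gt0.
pose k := B / a; pose f z := w z - barrier d a k x0 t0 z.1 z.2.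
have expB : B <= a * expR k.
  have := expR_ge1Dx k; rewrite -(ler_pM2l a0) mulrDr mulr1 /k [a * (B / a)]mulrC mulfVK ?gt_eqF//.
  lra.
(* Half-width at which the parabola reaches [B]: [d * L ^+ 2 = d + 2 * B + B ^+ 2 / d]. *)
pose L := 1 + B / d.
have L0 : 0 < L by rewrite addr_gt0 ?divr_gt0.
have dL : B <= d * L ^+ 2.
  have Bd : d * (B / d) = B by rewrite mulrC mulfVK ?gt_eqF.
  rewrite (_ : d * L ^+ 2 = d + 2 * (d * (B / d)) + d * (B / d) * (B / d)); last by rewrite /L; ring.
  rewrite Bd; have : 0 < B * (B / d) by rewrite mulr_gt0 ?divr_gt0.
  lra.
have subK : rectangle (x0 - L) (x0 + L) 0 (t0 + 1) `<=` strip (t0 + 1).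
  by move=> [x t] [_] /=; rewrite in_itv.
have cf : {within rectangle (x0 - L) (x0 + L) 0 (t0 + 1), continuous f}.
  apply: within_continuousB; first exact: continuous_subspaceW subK cw.
  exact/continuous_subspaceT/continuous_barrier.
have fz0 : 0 < f (x0, t0).
  by rewrite /f /barrier /= !subrr expr0n mulr0 add0r mulr0 expR0 mulr1 subr_gt0.
have ae t : 0 < a * expR (k * (t - t0)) by rewrite mulr_gt0 ?expR_gt0.
have dsq x : 0 <= d * (x - x0) ^+ 2 by rewrite mulr_ge0 ?sqr_ge0 ?ltW.
have [||x t xab tcd bd|z [z1 z2 fz zmax]] := interior_local_max (m := 0) cf (z0 := (x0, t0)).
- by split; rewrite /= in_itv/=; lra.
- exact: fz0.
- rewrite /f /barrier /=; have := dsq x; have := ae t.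
  have : w (x, t) <= B by exact: wB.
  case: bd => ->.
  + by rewrite (_ : x0 - L - x0 = - L) ?sqrrN; [lra|ring].
  + by rewrite (_ : x0 + L - x0 = L); [lra|ring].
  + by have := w0 x; lra.
  + by rewrite (_ : t0 + 1 - t0 = 1) ?mulr1; [lra|ring].
- exists z; split=> //; first by case/andP: z2.
  have wz : w z <= B.
    by apply: wB; case/andP: z2 => ? ?; rewrite /strip/= !ltW.
  move: (lt_le_trans fz0 fz); rewrite /f /barrier /=; have := ae z.2; lra.
Qed.

Lemma BUC_bound u T : BUC_finite_time u -> 0 < T ->
  {within strip T, continuous u} /\ exists B, forall z, strip T z -> `|u z| <= B.
Proof.
move=> bu T0; have [b c] := bu T T0.
split; first exact: unif_continuous_continuous.
have PF : ProperFilter (globally (strip T)).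
  apply: (@globally_properfilter _ _ ((0, 0) : R * R)).
  by rewrite /strip/= lexx ltW.
by have /ex_bound[B uB] := b; exists B.
Qed.

(** If [u] were positive somewhere, a barrier would touch it from above; there the time derivative
    is positive and [G] nonnegative, against the subsolution inequality. *)
Lemma subsolution_le0 G u : (forall x p, 0 <= G x p) ->
  cauchy_solution G (fun=> 0) u -> forall x t, 0 < t -> u (x, t) <= 0.
Proof.
move=> G0 [bu sub _ u0] x0 t0 t00; rewrite leNgt; apply/negP => upos.
have [|cu [B uB]] := BUC_bound (T := t0 + 1) bu; first by lra.
have [||||||k k0 /(_ 1 ltr01)[z [zt _ touch]]] := @barrier_max u B (u (x0, t0) / 2) x0 t0 => //.
- lra.
- by move=> z /uB; apply: le_trans; exact: ler_norm.
- by move=> x; rewrite u0.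
- lra.
have [C1 Ex Et] := barrier_test 1 (u (x0, t0) / 2) k x0 t0.
have := sub _ _ zt C1 touch; rewrite Et => le0.
have := G0 z.1 (Dx (fun z => barrier 1 (u (x0, t0) / 2) k x0 t0 z.1 z.2) z).
have : 0 < u (x0, t0) / 2 * (k * expR (k * (z.2 - t0))).
  by rewrite !mulr_gt0 ?expR_gt0.
lra.
Qed.

(** The barrier argument for [- u]. The kinetic term now has the unfavourable sign and is absorbed
    by flattening the parabola, that is, by a small [d]. *)
Lemma supersolution_ge0 (W : R -> R) u : (forall x, 0 <= W x) ->
    cauchy_solution (fun x p => - W x + 2^-1 * p ^+ 2) (fun=> 0) u ->
  forall x t, 0 < t -> 0 <= u (x, t).
Proof.
move=> W0 [bu _ super u0] x0 t0 t00; rewrite leNgt; apply/negP => uneg.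
have [|cu [B uB]] := BUC_bound (T := t0 + 1) bu; first by lra.
pose a := - u (x0, t0) / 2; have a0 : 0 < a by rewrite /a; lra.
have [||||k k0 barr] := @barrier_max (fun z => - u z) B a x0 t0 t00 a0.
- by move=> z; apply: cvgN; exact: cu.
- by move=> z /uB; apply: le_trans; rewrite -normrN; exact: ler_norm.
- by move=> x; rewrite u0 oppr0.
- rewrite /a; lra.
have B0 : 0 < B.
  have := uB (x0, t0); rewrite /strip/= => /(_ _); have := ler_norm (- u (x0, t0)).
  rewrite normrN => h1 h2; suff : `|u (x0, t0)| <= B by lra.
  by apply: h2; lra.
(* Lower bound, attained at time 0, for the time derivative of the exponential term. *)
pose q := a * (k * expR (k * (0 - t0))).
have q0 : 0 < q by exact: mulr_gt0 a0 (mulr_gt0 k0 (expR_gt0 _)).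
(* At the touching point the kinetic term is at most [2 * d * B], which this choice makes equal to
   [q / 2]. *)
pose d := q / (4 * B); have d0 : 0 < d by apply: divr_gt0 => //; exact: mulr_gt0.
have [z [zt zB touch]] := barr _ d0.
have [C1 Ex Et] := barrier_test (- d) (- a) k x0 t0.
have touch' : touches_below u (fun z => barrier (- d) (- a) k x0 t0 z.1 z.2) z.
  apply: filterS touch => y; rewrite /barrier; lra.
have := super _ _ zt C1 touch'; rewrite Et Ex.
have : q <= a * (k * expR (k * (z.2 - t0))).
  rewrite /q !ler_pM2l// ler_expR ler_pM2l// lerD2r; exact: ltW.
have : 2^-1 * (2 * - d * (z.1 - x0)) ^+ 2 <= 2 * d * B.
  rewrite (_ : _ * _ ^+ 2 = 2 * d * (d * (z.1 - x0) ^+ 2)); last by field.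
  by rewrite ler_pM2l// mulr_gt0.
have -> : 2 * d * B = q / 2 by rewrite /d; field; rewrite gt_eqF.
have := W0 z.1; lra.
Qed.
End Signs.

(** * Smooth strict subsolutions of log-sum-exp type *)

Section HopfColeBarrier.
Variable R : realType.
Implicit Types (kap l x t : R).

(** The exponential of [- (t - t ^+ 2 / (2 * t0)) / kap], with the square completed. *)
Definition time_weight kap t0 t : R :=
  expR ((2 * t0 * kap)^-1 * (t - t0) ^+ 2 - (2 * t0 * kap)^-1 * t0 ^+ 2).

(** The slope [Num.sqrt 2] is the one for which half its square equals 1, the lower bound of the
    potential near the origin. *)
Definition right_weight kap l x : R := expR (Num.sqrt 2 / kap * (x - l)).

Definition left_weight kap l x : R := expR (- (Num.sqrt 2 / kap) * (x - - l)).

Definition total_weight kap l t0 x t : R :=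
  time_weight kap t0 t + (right_weight kap l x + left_weight kap l x).

(* A smooth lower approximation, as [kap] tends to 0, of the minimum of
   [t - t ^+ 2 / (2 * t0)] and [Num.sqrt 2 * (l - `|x|)]. *)
Definition soft_min kap l t0 x t : R := - kap * ln (total_weight kap l t0 x t).

Lemma total_weight_gt0 kap l t0 x t : 0 < total_weight kap l t0 x t.
Proof. by rewrite !addr_gt0 ?expR_gt0. Qed.

Lemma is_derive_time_weight kap t0 t :
  is_derive t (1 : R) (time_weight kap t0)
    (time_weight kap t0 t * (2 * (2 * t0 * kap)^-1 * (t - t0))).
Proof.
set K := (2 * t0 * kap)^-1.
apply: (@is_derive1_comp _ expR (fun s => K * (s - t0) ^+ 2 - K * t0 ^+ 2)).
have := is_deriveB (is_derive_quadratic K t0 t) (is_derive_cst (K * t0 ^+ 2) t (1 : R)).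
by rewrite subr0.
Qed.

(** A partial derivative of the soft minimum averages those of the three functions, with the weights
    normalised by their total. *)
Definition soft_min_x kap l t0 x t : R :=
  - Num.sqrt 2 * ((right_weight kap l x - left_weight kap l x)
                  / total_weight kap l t0 x t).

Definition soft_min_t kap l t0 x t : R :=
  (1 - t / t0) * (time_weight kap t0 t / total_weight kap l t0 x t).

Lemma is_derive_soft_min_x kap l t0 x t : 0 < kap ->
  is_derive x (1 : R) (fun y => soft_min kap l t0 y t) (soft_min_x kap l t0 x t).
Proof.
move=> kap0; have E0 := total_weight_gt0 kap l t0 x t.
have dE : is_derive x (1 : R) (fun y => total_weight kap l t0 y t)
    (0 + (Num.sqrt 2 / kap * right_weight kap l x +
          - (Num.sqrt 2 / kap) * left_weight kap l x)).
  apply: is_deriveD; apply: is_deriveD; exact: is_derive_expR_affine.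
have := is_deriveZ (- kap) (@is_derive1_comp _ (@ln R)
  (fun y => total_weight kap l t0 y t) x _ _ (is_derive1_ln E0) dE).
move=> /is_derive_eq; apply; rewrite /soft_min_x /GRing.scale/=.
by field; rewrite !gt_eqF.
Qed.

Lemma is_derive_soft_min_t kap l t0 x t : 0 < kap -> 0 < t0 ->
  is_derive t (1 : R) (soft_min kap l t0 x) (soft_min_t kap l t0 x t).
Proof.
move=> kap0 t00; have E0 := total_weight_gt0 kap l t0 x t.
have dE : is_derive t (1 : R) (total_weight kap l t0 x)
    (time_weight kap t0 t * (2 * (2 * t0 * kap)^-1 * (t - t0)) + 0).
  apply: is_deriveD; exact: is_derive_time_weight.
have := is_deriveZ (- kap) (@is_derive1_comp _ (@ln R)
  (total_weight kap l t0 x) t _ _ (is_derive1_ln E0) dE).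
move=> /is_derive_eq; apply; rewrite /soft_min_t /GRing.scale/=.
by field; rewrite !gt_eqF.
Qed.

Lemma continuous_time_weight kap t0 :
  continuous (fun z : R * R => time_weight kap t0 z.2).
Proof.
move=> z; apply: (@continuous_comp _ _ _ snd (time_weight kap t0)); first exact: cvg_snd.
apply/differentiable_continuous/derivable1_diffP.
by have [] := is_derive_time_weight kap t0 z.2.
Qed.

Lemma continuous_right_weight kap l :
  continuous (fun z : R * R => right_weight kap l z.1).
Proof.
move=> z; apply: (@continuous_comp _ _ _ fst (right_weight kap l)); first exact: cvg_fst.
apply/differentiable_continuous/derivable1_diffP.
by have [] := is_derive_expR_affine (Num.sqrt 2 / kap) l z.1.
Qed.

Lemma continuous_left_weight kap l :
  continuous (fun z : R * R => left_weight kap l z.1).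
Proof.
move=> z; apply: (@continuous_comp _ _ _ fst (left_weight kap l)); first exact: cvg_fst.
apply/differentiable_continuous/derivable1_diffP.
by have [] := is_derive_expR_affine (- (Num.sqrt 2 / kap)) (- l) z.1.
Qed.

Lemma continuous_total_weight kap l t0 :
  continuous (fun z : R * R => total_weight kap l t0 z.1 z.2).
Proof.
move=> z; apply: cvgD; first exact: continuous_time_weight.
by apply: cvgD; [exact: continuous_right_weight|exact: continuous_left_weight].
Qed.

Lemma continuous_soft_min kap l t0 :
  continuous (fun z : R * R => soft_min kap l t0 z.1 z.2).
Proof.
move=> z; apply: cvgM; first exact: cvg_cst.
apply: (@continuous_comp _ _ _ (fun z => total_weight kap l t0 z.1 z.2) (@ln R)).
  exact: continuous_total_weight.
exact: continuous_ln (total_weight_gt0 _ _ _ _ _).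
Qed.

Lemma soft_min_test kap l t0 : 0 < kap -> 0 < t0 ->
  let f := fun z => soft_min kap l t0 z.1 z.2 in
  [/\ C1_spacetime f, Dx f = fun z => soft_min_x kap l t0 z.1 z.2
    & Dt f = fun z => soft_min_t kap l t0 z.1 z.2].
Proof.
move=> kap0 t00; apply: (@test_functionP R (soft_min kap l t0)
  (soft_min_x kap l t0) (soft_min_t kap l t0)) => [x t|x t|z|z].
- exact: is_derive_soft_min_x.
- exact: is_derive_soft_min_t.
- apply: cvgM; first exact: cvg_cst.
  apply: cvgM; last first.
    apply: cvgV; last exact: continuous_total_weight.
    by rewrite gt_eqF ?total_weight_gt0.
  by apply: cvgB; [exact: continuous_right_weight|exact: continuous_left_weight].
- apply: cvgM.
    apply: cvgB; first exact: cvg_cst.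
    by apply: cvgM; [exact: cvg_snd|exact: cvg_cst].
  apply: cvgM; first exact: continuous_time_weight.
  apply: cvgV; last exact: continuous_total_weight.
  by rewrite gt_eqF ?total_weight_gt0.
Qed.

(* In terms of the weights [a], [b], [c] normalised to sum to 1, the left-hand
   side is at most [a + (b - c) ^+ 2 < a + b + c]. *)
Lemma soft_min_strict_subsolution kap l t0 x t : 0 < t0 -> 0 < t ->
  soft_min_t kap l t0 x t + 2^-1 * soft_min_x kap l t0 x t ^+ 2 < 1.
Proof.
move=> t00 tpos; rewrite /soft_min_t /soft_min_x.
have E0 := total_weight_gt0 kap l t0 x t.
set E := total_weight kap l t0 x t in E0 *.
have s2 : Num.sqrt 2 ^+ 2 = 2 :> R by rewrite sqr_sqrtr.
rewrite exprMn sqrrN s2 [2^-1 * _]mulrA mulVf// mul1r !mulrBl mul1r.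
pose a := time_weight kap t0 t / E; pose b := right_weight kap l x / E.
pose c := left_weight kap l x / E; rewrite -/a -/b -/c.
have a0 : 0 < a by rewrite divr_gt0 ?expR_gt0.
have b0 : 0 < b by rewrite divr_gt0 ?expR_gt0.
have c0 : 0 < c by rewrite divr_gt0 ?expR_gt0.
have abc : a + (b + c) = 1 by rewrite /a /b /c -!mulrDl divff ?gt_eqF.
(* By [abc], the gap to 1 is exactly [t / t0 * a + 4 * (b * c) + a * (b + c)]. *)
have : 0 < t / t0 * a by exact: mulr_gt0 (divr_gt0 tpos t00) a0.
have : 0 < b * c by exact: mulr_gt0.
have : 0 < a * (b + c) by exact: mulr_gt0 a0 (addr_gt0 b0 c0).
nra.
Qed.

(** On each side of the rectangle one of the three weights equals 1, so the logarithm of the total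
    is nonnegative. *)
Lemma soft_min_le0 kap l t0 x t : 0 < kap -> 0 < t0 ->
  [\/ x = - l, x = l, t = 0 | t = 2 * t0] -> soft_min kap l t0 x t <= 0.
Proof.
move=> kap0 t00 bd; rewrite /soft_min mulNr oppr_le0 mulr_ge0 ?(ltW kap0)// ln_ge0//.
rewrite /total_weight /time_weight /right_weight /left_weight.
set K := (2 * t0 * kap)^-1.
have := expR_gt0 (K * (t - t0) ^+ 2 - K * t0 ^+ 2).
have := expR_gt0 (Num.sqrt 2 / kap * (x - l)).
have := expR_gt0 (- (Num.sqrt 2 / kap) * (x - - l)).
case: bd => ->.
- rewrite subrr mulr0 expR0; lra.
- rewrite subrr mulr0 expR0; lra.
- rewrite sub0r sqrrN subrr expR0; lra.
- rewrite (_ : 2 * t0 - t0 = t0) ?subrr ?expR0; [lra|ring].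
Qed.

Lemma soft_min_center_ge kap l t0 : 0 < kap -> 0 < t0 ->
  Num.sqrt 2 * l <= t0 / 2 -> Num.sqrt 2 * l - 2 * kap <= soft_min kap l t0 0 t0.
Proof.
move=> kap0 t00 lt0; have E0 := total_weight_gt0 kap l t0 0 t0.
set M := Num.sqrt 2 * l in lt0 *.
(* Each of the three weights is at most [expR (- (M / kap))], and [3 <= expR 2]; this is the source
   of the error [2 * kap]. *)
suff : total_weight kap l t0 0 t0 <= expR (2 - M / kap).
  rewrite -ler_ln ?posrE ?expR_gt0// expRK => lnE.
  have := ler_wpM2l (ltW kap0) lnE.
  rewrite /soft_min mulrBr (_ : kap * (M / kap) = M); first lra.
  by rewrite mulrC mulfVK ?gt_eqF.
rewrite /total_weight /time_weight /right_weight /left_weight [leRHS]expRD.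
have -> : Num.sqrt 2 / kap * (0 - l) = - (M / kap) by rewrite /M; ring.
have -> : - (Num.sqrt 2 / kap) * (0 - - l) = - (M / kap) by rewrite /M; ring.
have : expR ((2 * t0 * kap)^-1 * (t0 - t0) ^+ 2 - (2 * t0 * kap)^-1 * t0 ^+ 2)
       <= expR (- (M / kap)).
  rewrite ler_expR subrr expr0n mulr0 sub0r lerN2.
  rewrite (_ : _ * t0 ^+ 2 = t0 / 2 / kap); last by field; rewrite !gt_eqF.
  by rewrite ler_pM2r ?invr_gt0.
have := ler_wpM2r (expR_ge0 (- (M / kap))) (expR_ge1Dx (2 : R)).
lra.
Qed.
End HopfColeBarrier.

(** * Lower bound at the origin and the final estimate *)

(** Otherwise the soft minimum minus [u] has a positive interior maximum on [[-l, l] x [0, 2 * t0]],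
    so the soft minimum touches [u] from below where [W >= 1], against its being a strict
    subsolution. *)
Lemma supersolution_ge_min (R : realType) (W : R -> R) (l t0 : R)
    (u : R * R -> R) :
    0 < l -> 0 < t0 -> Num.sqrt 2 * l <= t0 / 2 ->
    (forall x, 0 <= W x) -> (forall x, - l <= x <= l -> 1 <= W x) ->
    cauchy_solution (fun x p => - W x + 2^-1 * p ^+ 2) (fun=> 0) u ->
  Num.sqrt 2 * l <= u (0, t0).
Proof.
move=> l0 t00 lt0 W0 W1 uP; apply/ler_addgt0Pr => e e0.
have uge0 := supersolution_ge0 W0 uP; case: uP => bu _ super u0.
have [|cu _] := BUC_bound (T := 2 * t0) bu; first by lra.
(* Turns the error [2 * kap] at the centre into [e]. *)
pose kap := e / 2; have kap0 : 0 < kap by rewrite divr_gt0.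
have center := soft_min_center_ge kap0 t00 lt0.
rewrite leNgt; apply/negP => small.
pose f z := soft_min kap l t0 z.1 z.2 - u z.
have subK : rectangle (- l) l 0 (2 * t0) `<=` strip (2 * t0).
  by move=> [x t] [_] /=; rewrite in_itv.
have cf : {within rectangle (- l) l 0 (2 * t0), continuous f}.
  apply: within_continuousB; last exact: continuous_subspaceW subK cu.
  exact/continuous_subspaceT/continuous_soft_min.
have [|||z [z1 z2 _ zmax]] := interior_local_max (m := 0) cf (z0 := (0, t0)).
- by split; rewrite /= in_itv/=; lra.
- rewrite /f /= subr_gt0 (lt_le_trans _ center)// /kap; lra.
- move=> x t xl tl bd; rewrite /f subr_le0 /= (le_trans (soft_min_le0 kap0 t00 bd))//.
  (* The initial datum handles time 0, since [uge0] covers positive times only. *)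
  case/andP: tl; rewrite le_eqVlt => /predU1P[<-|t_gt0] _; first by rewrite u0.
  exact: uge0.
have [C1 Ex Et] := soft_min_test l kap0 t00.
have zt : spacetime z by case/andP: z2.
have touch : touches_below u (fun z => soft_min kap l t0 z.1 z.2) z.
  by apply: filterS zmax => w; rewrite /f; lra.
have := super _ _ zt C1 touch; rewrite Ex Et.
have := soft_min_strict_subsolution kap l z.1 t00 zt.
have : 1 <= W z.1 by apply: W1; case/andP: z1 => z1l z1r; rewrite !ltW.
lra.
Qed.

Theorem proposition4p1 (R : realType) (V : R -> R)
    (V_continuous : continuous V) (V_periodic : periodic V 1)
    (V_ge0 : forall y, 0 <= V y) (V_min0 : exists y, V y = 0)
    (V_ge1 : forall y, - (1 / 3) <= y <= 1 / 3 -> 1 <= V y)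
    (Hbar : R -> R) (HbarP : effective_hamiltonian (mechanical V) Hbar)
    (ueps : R -> R * R -> R)
    (uepsP : forall eps, 0 < eps ->
       cauchy_solution (fun x p => mechanical V (x / eps) p) (fun=> 0)
         (ueps eps))
    (u : R * R -> R) (uP : cauchy_solution (fun _ p => Hbar p) (fun=> 0) u) :
  forall eps t : R, 0 < eps < 1 -> 0 < t ->
    Num.sqrt 2 / 3 * Num.min t eps <= ueps eps (0, t) - u (0, t).
Proof.
move=> eps t /andP[eps0 _] t0.
have [y0 Vy0] := V_min0.
have u_le0 : u (0, t) <= 0.
  apply: subsolution_le0 uP _ _ t0 => _ p.
  by have [cell _] := HbarP p; exact: cell_solvable_ge0 Vy0 cell.
set m := Num.min t eps.
have m0 : 0 < m by rewrite lt_min t0.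
have mt : m <= t by rewrite ge_min lexx.
have meps : m <= eps by rewrite ge_min lexx orbT.
(* With [l = m / 3] and [m <= t], this gives [Num.sqrt 2 * l <= t / 2]: the time parabola, of height
   [t / 2], does not lower the minimum at the centre. *)
have s32 : Num.sqrt 2 <= 3 / 2 :> R.
  by rewrite -[leRHS]ger0_norm// -sqrtr_sqr ler_wsqrtr//; lra.
suff : Num.sqrt 2 * (m / 3) <= ueps eps (0, t) by rewrite mulrA mulrAC; lra.
apply: (supersolution_ge_min (W := fun x => V (x / eps))) (uepsP _ eps0) => //.
- by rewrite divr_gt0.
- have := ler_wpM2r (ltW m0) s32; lra.
- move=> x /andP[x1 x2]; apply: V_ge1.
  by rewrite ler_pdivlMr// ler_pdivrMr//; lra.
Qed.
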